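(* For every integer $N\geq 1$, $$\sum_{n=1}^N\tau(n^2+1)<1.216\cdot N\log N+4.332\cdot N.$$
   Context: $\tau(m)$ denotes the number of positive divisors of the positive integer $m$; $\log$ is the natural logarithm. *)

(* Defs.v *)
From HB Require Import structures.
From mathcomp Require Import all_boot all_order all_algebra.
From mathcomp Require Import reals exp.

Set Implicit Arguments.
Unset Strict Implicit.
Unset Printing Implicit Defensive.

Definition tau (m : nat) : nat := size (divisors m).

(* Main.v *)
(* Divisors of n^2 + 1 come in pairs with one member at most n, so the sum is at
   most 2 sum_{d <= N} rho(d) floor(N / d), where rho(d) counts the square roots
   of -1 modulo d. If rho(d) > 0 then neither 4 nor 3 divides d, every odd divisor
   of d is 1 modulo 4, and rho(d) is at most the number of divisors of the odd
   part m of d. Hence rho(d) <= r(m), with r(m) = sum_{a | m} chi_4(a) >= 0, where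
   m is prime to 6 and d = m or d = 2m. With O(x) = sum_{b <= x, (b,6) = 1} 1/b,
     sum_{m <= N, (m,6) = 1} r(m)/m = sum_{(a,6) = 1} chi_4(a)/a O(N/a),
   and as O(N/a)/a decreases while the signs of chi_4 run through + + - - on
   1, 5, 7, 11 modulo 12, this is at most O(N) + O(N/5)/5 <= 6/5 O(N). Finally
   O(N) <= 1 + (log N)/3, so the sum is at most
   2 * 3/2 * 6/5 N O(N) <= 1.2 N log N + 3.6 N. *)
Require Import Defs.
From HB Require Import structures.
From mathcomp Require Import all_boot all_order all_algebra.
From mathcomp Require Import reals exp.
From mathcomp Require Import zify ring lra.

Set Implicit Arguments.
Unset Strict Implicit.
Unset Printing Implicit Defensive.

(** * Square roots of -1 *)

(** A divisor above n is sent to its codivisor, which is at most n because n^2 + 1 < (n + 1)^2 for n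
    > 0. This map is injective, so large divisors are no more numerous than small ones. *)
Lemma tau_le_small_divisors (n : nat) : (0 < n)%N ->
  (tau (n ^ 2 + 1) <= 2 * \sum_(1 <= d < n.+1) (d %| n ^ 2 + 1))%N.
Proof.
move=> n0; set m := (n ^ 2 + 1)%N.
have m0 : (0 < m)%N by rewrite /m addn1.
have Em : m = (n ^ 2 + 1)%N by [].
clearbody m.
pose s := [seq d <- iota 1 n | d %| m].
have -> : (\sum_(1 <= d < n.+1) (d %| m) = size s)%N.
  rewrite size_filter -sum1_count [RHS]big_mkcond /index_iota subn1.
  by apply: eq_bigr => d _; case: dvdn.
rewrite /tau -(count_predC (fun d => d <= n)%N (divisors m)) mul2n -addnn.
apply: leq_add; rewrite -size_filter.
  apply: uniq_leq_size => [|d]; first by rewrite filter_uniq ?divisors_uniq.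
  rewrite !mem_filter mem_iota -dvdn_divisors // => /andP[dn dm].
  by rewrite dm (dvdn_gt0 m0 dm) /= add1n ltnS.
rewrite -(size_map (fun d => m %/ d)%N); apply: uniq_leq_size => [|_ /mapP[d + ->]].
  rewrite map_inj_in_uniq ?filter_uniq ?divisors_uniq // => d e.
  rewrite !mem_filter -!dvdn_divisors // => /andP[_ dm] /andP[_ em] E.
  have e0 := dvdn_gt0 m0 em.
  have q0 : 0 < m %/ e by rewrite divn_gt0 // dvdn_leq.
  apply/eqP; rewrite -(eqn_pmul2l q0) -{1}E.
  by rewrite !(mulnC (_ %/ _)) !(mulnC _ (_ %/ _)) !divnK.
rewrite !mem_filter mem_iota -dvdn_divisors //= -ltnNge => /andP[dn dm].
have d0 := dvdn_gt0 m0 dm.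
have E := divnK dm; rewrite -{2}E dvdn_mulr // divn_gt0 // dvdn_leq //= add1n.
by rewrite ltn_divLR // Em; nia.
Qed.

Definition rho (d : nat) : nat := \sum_(0 <= x < d) (d %| x ^ 2 + 1).

Lemma dvdn_sqr1_mod (d x : nat) : (d %| (x %% d) ^ 2 + 1) = (d %| x ^ 2 + 1).
Proof. by rewrite /dvdn -modnDml modnXm modnDml. Qed.

(** The q = N %/ d blocks of length d starting at d cover all n from d to N, since N < d + q * d,
    and each block holds [rho d] roots. Leaving out n < d is what gives the floor of N / d instead
    of the ceiling. *)
Lemma count_roots_interval (d N : nat) : (0 < d)%N ->
  (\sum_(1 <= n < N.+1 | d <= n) (d %| n ^ 2 + 1) <= rho d * (N %/ d))%N.
Proof.
move=> d0.
have period q :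
    (\sum_(d <= n < d + q * d) (d %| n ^ 2 + 1) = q * rho d)%N.
  elim: q => [|q IH]; first by rewrite mul0n addn0 big_geq.
  rewrite (@big_cat_nat _ _ _ (d + q * d)%N) ?leq_addr ?mulSn //=; last first.
    by rewrite leq_add2l leq_addl.
  rewrite IH addnC; congr addn.
  rewrite /rho -{1}[(d + q * d)%N]add0n big_addn addnK.
  apply: eq_bigr => x _; congr (nat_of_bool _).
  by rewrite -dvdn_sqr1_mod -mulSn (addnC x) modnMDl dvdn_sqr1_mod.
have [Nd|dN] := ltnP N d.
  rewrite big_nat_cond big1 // => n /andP[/andP[_ nN] dn].
  by move: (leq_ltn_trans (leq_trans dn nN) Nd); rewrite ltnn.
rewrite mulnC -period [leqRHS](@big_cat_nat _ _ _ N.+1) //=; last 2 first.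
- exact: leq_trans dN _.
- by rewrite {1}(divn_eq N d) [ltnRHS]addnC ltn_add2l ltn_mod.
apply: leq_trans (leq_addr _ _).
rewrite (@big_cat_nat _ _ _ d) //=; last exact: leq_trans dN _.
rewrite big_nat_cond big1 ?add0n; last by move=> n; lia.
by rewrite [leqRHS]big_nat big_nat_cond leq_eqVlt; apply/orP; left; apply/eqP;
   apply: eq_bigl => n; case: (d <= n)%N; rewrite ?andbT ?andbF.
Qed.

Lemma sum_tau_le_rho (N : nat) :
  (\sum_(1 <= n < N.+1) tau (n ^ 2 + 1)
     <= 2 * \sum_(1 <= d < N.+1) rho d * (N %/ d))%N.
Proof.
apply: (@leq_trans (2 * \sum_(1 <= n < N.+1)
    \sum_(1 <= d < N.+1 | d <= n) (d %| n ^ 2 + 1))%N).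
  rewrite big_distrr /= !big_nat; apply: leq_sum => n /andP[n0 nN].
  apply: leq_trans (tau_le_small_divisors n0) _; rewrite leq_mul2l /=.
  rewrite [leqRHS](@big_cat_nat _ _ _ n.+1) //=.
  apply: leq_trans (leq_addr _ _).
  rewrite big_nat_cond [leqRHS]big_nat_cond leq_eqVlt; apply/orP; left; apply/eqP.
  by apply: eq_bigl => d; rewrite ltnS; case: (d <= n)%N; rewrite ?andbT ?andbF.
rewrite leq_mul2l /= (exchange_big_dep_nat xpredT) //=.
rewrite !big_nat; apply: leq_sum => d /andP[d0 _].
exact: count_roots_interval.
Qed.

(** Descent on e: the root can be taken even and below e, replacing y by e - y if needed. Then y^2 +
    1 = f * e is 1 modulo 4, so e = 3 modulo 4 would force f = 3 modulo 4 with f < e. *)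
Lemma dvdn_sqr1_mod4 (e x : nat) : odd e -> e %| x ^ 2 + 1 -> e %% 4 = 1.
Proof.
elim/ltn_ind: e x => e IH x oe ex.
have [//|e3] : e %% 4 = 1 \/ e %% 4 = 3 by lia.
have e0 : 0 < e by lia.
have [y [ey ye]] : exists y, e %| y ^ 2 + 1 /\ (y < e) /\ ~~ odd y.
  have xe : x %% e < e by rewrite ltn_mod.
  move: ex; rewrite -dvdn_sqr1_mod => ex.
  have [ox|nx] := boolP (odd (x %% e)); last by exists (x %% e).
  exists (e - x %% e); split; last by rewrite oddB ?oe ?ox //=; lia.
  (* With t = x %% e, adding 2te states (e - t)^2 = e^2 - 2te + t^2 without truncated
     subtraction. *)
  rewrite -(@dvdn_addl (2 * (x %% e) * e)) ?dvdn_mull //.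
  have -> : (e - x %% e) ^ 2 + 1 + 2 * (x %% e) * e = e * e + ((x %% e) ^ 2 + 1).
    move: (x %% e) xe => t te; have [s ->] : exists s, e = t + s.
      by exists (e - t); rewrite subnKC // ltnW.
    by rewrite addKn; ring.
  by rewrite dvdn_add // dvdn_mulr.
case: ye => ye ny; have /dvdnP[f Ef] := ey.
have f3 : f %% 4 = 3.
  have : (f %% 4) * (e %% 4) = 1 %[mod 4].
    rewrite modnMml modnMmr -Ef -(odd_double_half y) (negPf ny) add0n.
    by rewrite -muln2 expnMn modnMDl.
  rewrite e3; have : f %% 4 < 4 by rewrite ltn_mod.
  by case: (f %% 4) => [|[|[|[|]]]].
have fe : f < e.
  rewrite -(ltn_pmul2r e0) -Ef -mulnn addn1.
  apply: (@leq_ltn_trans (y * e).+1); first by rewrite ltnS leq_mul2l ltnW ?orbT.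
  have e1 : 1 < e by case: (e) e3 => [|[]].
  by apply: leq_trans (leq_mul ye (leqnn e)); rewrite mulSn -(add1n (y * e)) ltn_add2r.
have := IH f fe y; rewrite f3 Ef dvdn_mulr //.
by move=> H; have : 3 = 1 by apply: H => //; rewrite -(@odd_mod f 4 erefl) f3.
Qed.

Lemma rho_mul3 (d : nat) : 3 %| d -> rho d = 0.
Proof.
move=> d3; rewrite /rho big1 // => x _; apply/eqP; rewrite eqb0.
apply/negP => /(dvdn_trans d3); rewrite -dvdn_sqr1_mod.
have : x %% 3 < 3 by rewrite ltn_mod.
by case: (x %% 3) => [|[|[|]]].
Qed.

Lemma rho_mul4 (d : nat) : 4 %| d -> rho d = 0.
Proof.
move=> d4; rewrite /rho big1 // => x _; apply/eqP; rewrite eqb0.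
apply/negP => /(dvdn_trans d4); rewrite -dvdn_sqr1_mod.
have : x %% 4 < 4 by rewrite ltn_mod.
by case: (x %% 4) => [|[|[|[|]]]].
Qed.

Definition sqrtN1_mod (d : nat) : seq nat := [seq x <- iota 0 d | d %| x ^ 2 + 1].

Lemma rhoE (d : nat) : rho d = size (sqrtN1_mod d).
Proof.
rewrite /rho size_filter -sum1_count [RHS]big_mkcond /index_iota subn0.
by apply: eq_bigr => x _; case: dvdn.
Qed.

Lemma mem_sqrtN1_mod (d x : nat) :
  (x \in sqrtN1_mod d) = (x < d) && (d %| x ^ 2 + 1).
Proof. by rewrite mem_filter mem_iota andbC. Qed.

Lemma sqrtN1_mod_uniq (d : nat) : uniq (sqrtN1_mod d).
Proof. by rewrite filter_uniq ?iota_uniq. Qed.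

(** Reduction modulo m is injective on the roots modulo 2m: these are all odd, hence equal modulo 2,
    and 2 is prime to m. *)
Lemma rho_double (m : nat) : odd m -> rho (m.*2) <= rho m.
Proof.
move=> om; have m0 : 0 < m by case: m om.
rewrite !rhoE -(size_map (modn^~ m)).
apply: uniq_leq_size => [|_ /mapP[x + ->]]; last first.
  rewrite !mem_sqrtN1_mod ltn_mod m0 dvdn_sqr1_mod => /andP[_].
  by apply: dvdn_trans; rewrite -muln2 dvdn_mulr.
rewrite map_inj_in_uniq ?sqrtN1_mod_uniq // => x y.
have oddroot z : m.*2 %| z ^ 2 + 1 -> odd z.
  move=> mz; have : 2 %| z ^ 2 + 1 by apply: dvdn_trans mz; rewrite -muln2 dvdn_mull.
  by rewrite dvdn2 oddD oddX /= addbT negbK.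
rewrite !mem_sqrtN1_mod => /andP[xm /oddroot ox] /andP[ym /oddroot oy] E.
apply/eqP; rewrite -(modn_small xm) -(modn_small ym) -mul2n.
rewrite chinese_remainder ?coprime2n //.
by rewrite !modn2 ox oy E !eqxx.
Qed.

(* Once a root z is fixed, any root x is determined by g = gcd(m, x + z): x = -z
   modulo g, x = z modulo m / g, and g is prime to m / g because m is odd. *)
Lemma rho_le_divisors (m : nat) : odd m -> rho m <= size (divisors m).
Proof.
move=> om; have m0 : 0 < m by case: m om.
rewrite rhoE; case E: (sqrtN1_mod m) => [//|z s]; rewrite -E.
have : z \in sqrtN1_mod m by rewrite E mem_head.
rewrite mem_sqrtN1_mod => /andP[zm mz] {s E}.
have split_root x : x \in sqrtN1_mod m ->
    let g := gcdn m (x + z) in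
    [/\ coprime g (m %/ g), g %| x + z & m %/ g %| x + (m - z)].
  rewrite mem_sqrtN1_mod => /andP[_ mx] g.
  have gm : g %| m := dvdn_gcdl _ _.
  have gu : g %| x + z := dvdn_gcdr _ _.
  have g0 : 0 < g by rewrite gcdn_gt0 m0.
  (* Here m - z stands for -z: m divides x^2 - z^2 = (x + z)(x - z), and m / g is prime to (x + z) /
     g. *)
  have hv : m %/ g %| x + (m - z).
    rewrite -(@Gauss_dvdr _ ((x + z) %/ g)); last first.
      by rewrite /coprime -(eqn_pmul2r g0) mul1n muln_gcdl !divnK.
    rewrite -(dvdn_pmul2r g0) mulnAC !divnK //.
    rewrite -(@dvdn_addl (z ^ 2 + 1)) //.
    have -> : (x + z) * (x + (m - z)) + (z ^ 2 + 1) = x ^ 2 + 1 + m * (x + z).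
      have [s ->] : exists s, m = z + s by exists (m - z); rewrite subnKC // ltnW.
      by rewrite addKn; ring.
    by rewrite dvdn_add // dvdn_mulr.
  (* The common divisor c divides (x + z) + (x + (m - z)) = 2x + m. Being odd, it divides x, and
     then x^2 + 1 leaves c dividing 1. *)
  split=> //; rewrite /coprime -dvdn1; set c := gcdn g _.
  have cg : c %| g := dvdn_gcdl _ _.
  have cm := dvdn_trans cg gm.
  have cu := dvdn_trans cg gu.
  have cv : c %| x + (m - z) := dvdn_trans (dvdn_gcdr _ _) hv.
  have oc := dvdn_odd cm om.
  have cx : c %| x.
    rewrite -(@Gauss_dvdr _ 2) ?coprimen2 // -(@dvdn_addl m) //.
    suff -> : 2 * x + m = (x + z) + (x + (m - z)) by rewrite dvdn_add.
    by rewrite addnACA subnKC 1?ltnW // addnn mul2n.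
  by have := dvdn_trans cm mx; rewrite dvdn_addr // -mulnn dvdn_mulr.
rewrite -(size_map (fun x => gcdn m (x + z))).
apply: uniq_leq_size => [|_ /mapP[x _ ->]]; last first.
  by rewrite -dvdn_divisors ?dvdn_gcdl.
rewrite map_inj_in_uniq ?sqrtN1_mod_uniq // => x y mx my Exy.
have /= [cop gx hx] := split_root x mx; have /= [_] := split_root y my.
rewrite -Exy; move: (gcdn _ _) (dvdn_gcdl m (x + z)) cop gx hx.
move=> g gm cop gx hx gy hy; apply/eqP.
move: mx my; rewrite !mem_sqrtN1_mod => /andP[xm _] /andP[ym _].
rewrite -(modn_small xm) -(modn_small ym) -(divnK gm) mulnC.
rewrite chinese_remainder // -(eqn_modDr z).
rewrite -[(_ == _ %[mod _ %/ _])](eqn_modDr (m - z)).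
by move: gx gy hx hy; rewrite /dvdn => /eqP-> /eqP-> /eqP-> /eqP->; rewrite !eqxx.
Qed.

(** * The divisor sums of the nontrivial character modulo 4 *)

Lemma perm_divisorsM (m n : nat) : 0 < m -> 0 < n -> coprime m n ->
  perm_eq (divisors (m * n)) [seq a * b | a <- divisors m, b <- divisors n].
Proof.
move=> m0 n0 mn; apply: uniq_perm => [||d].
- exact: divisors_uniq.
- apply: allpairs_uniq; rewrite ?divisors_uniq // => -[a b] [a' b'].
  have gcd_fst u v : u %| m -> v %| n -> gcdn m (u * v) = u.
    move=> um vn; rewrite Gauss_gcdl ?(coprime_dvdr vn) //.
    by apply/eqP; rewrite eqn_dvd dvdn_gcdr dvdn_gcd um dvdnn.
  move=> /allpairsP[[x y] [/= + + [ex ey]]] /allpairsP[[x' y'] [/= + + [ex' ey']]].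
  rewrite -ex -ey -ex' -ey' -!dvdn_divisors // => am bn a'm b'n /= E.
  have Ea : a = a' by rewrite -(gcd_fst _ _ am bn) E gcd_fst.
  move/eqP: E; rewrite -Ea eqn_pmul2l ?(dvdn_gt0 m0 am) // => /eqP->.
  by [].
- rewrite -dvdn_divisors ?muln_gt0 ?m0 //; apply/idP/allpairsP => [dmn|]; last first.
    by case=> -[a b] [/=]; rewrite -!dvdn_divisors // => am bn ->; rewrite dvdn_mul.
  have d0 : 0 < d by apply: dvdn_gt0 dmn; rewrite muln_gt0 m0.
  have g0 : 0 < gcdn d m by rewrite gcdn_gt0 d0.
  exists (gcdn d m, d %/ gcdn d m) => /=.
  rewrite -!dvdn_divisors // dvdn_gcdr mulnC divnK ?dvdn_gcdl //; split=> //.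
  rewrite -(@Gauss_dvdr _ (m %/ gcdn d m)); last first.
    by rewrite /coprime -(eqn_pmul2r g0) mul1n muln_gcdl !divnK ?dvdn_gcdl ?dvdn_gcdr.
  by rewrite -(dvdn_pmul2r g0) mulnAC !divnK ?dvdn_gcdl ?dvdn_gcdr.
Qed.

Lemma perm_divisors_pfactor (p k : nat) : prime p ->
  perm_eq (divisors (p ^ k)) [seq p ^ i | i <- iota 0 k.+1].
Proof.
move=> pp; apply: uniq_perm => [||d].
- exact: divisors_uniq.
- rewrite map_inj_in_uniq ?iota_uniq // => i j _ _ /eqP.
  by rewrite eqn_exp2l ?prime_gt1 // => /eqP.
- rewrite -dvdn_divisors ?expn_gt0 ?prime_gt0 //.
  apply/(dvdn_pfactor _ _ pp)/mapP => -[i ik ->]; exists i => //.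
    by rewrite mem_iota.
  by move: ik; rewrite mem_iota.
Qed.

Import Order.TTheory GRing.Theory Num.Theory.
Local Open Scope ring_scope.

Definition chi4 (n : nat) : int := (n %% 4 == 1)%N%:R - (n %% 4 == 3)%N%:R.

Lemma chi4M (m n : nat) : chi4 (m * n) = chi4 m * chi4 n.
Proof.
rewrite /chi4 -modnMm.
have : (m %% 4 < 4)%N by rewrite ltn_mod.
have : (n %% 4 < 4)%N by rewrite ltn_mod.
by case: (n %% 4)%N => [|[|[|[|//]]]] _; case: (m %% 4)%N => [|[|[|[|//]]]].
Qed.

Lemma chi4X (m k : nat) : chi4 (m ^ k) = chi4 m ^+ k.
Proof. by elim: k => [//|k IH]; rewrite expnS chi4M IH exprS. Qed.

(** By Jacobi's two-square theorem, for n > 0 this is a quarter of the number of representations of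
    n as a sum of two squares. *)
Definition r4 (n : nat) : int := \sum_(a <- divisors n) chi4 a.

Lemma r4M (m n : nat) : (0 < m)%N -> (0 < n)%N -> coprime m n ->
  r4 (m * n) = r4 m * r4 n.
Proof.
move=> m0 n0 mn; rewrite /r4 (perm_big _ (perm_divisorsM m0 n0 mn)) /=.
rewrite big_allpairs_dep mulr_suml; apply: eq_bigr => a _.
by rewrite mulr_sumr; apply: eq_bigr => b _; rewrite chi4M.
Qed.

(** The sum is 1 + c + ... + c^k with c = [chi4 p] in {0, 1, -1}; for c = -1 it alternates between 1
    and 0. *)
Lemma r4_pfactor_ge0 (p k : nat) : prime p -> 0 <= r4 (p ^ k).
Proof.
move=> pp; rewrite /r4 (perm_big _ (perm_divisors_pfactor k pp)) big_map.
rewrite -[iota 0 k.+1]/(index_iota 0 k.+1).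
under eq_bigr do rewrite chi4X.
have : chi4 p \in [:: 0; 1; -1].
  rewrite /chi4; have : (p %% 4 < 4)%N by rewrite ltn_mod.
  by case: (p %% 4)%N => [|[|[|[|//]]]].
rewrite !inE => /or3P[] /eqP->; [| |].
- by apply: sumr_ge0 => i _; rewrite exprn_ge0.
- by apply: sumr_ge0 => i _; rewrite exprn_ge0.
suff -> : \sum_(0 <= i < k.+1) (-1) ^+ i = (~~ odd k)%:R :> int by [].
elim: k => [|k IH]; first by rewrite big_nat1.
by rewrite big_nat_recr //= IH -signr_odd /=; case: (odd k).
Qed.

Lemma r4_ge0 (n : nat) : (0 < n)%N -> 0 <= r4 n.
Proof.
elim/ltn_ind: n => n IH n0.
have [n1|n1] := leqP n 1.
  by rewrite (_ : n = 1%N) ?/r4 ?big_seq1 //; apply/eqP; rewrite eqn_leq n1.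
have pp := pdiv_prime n1; set p := pdiv n in pp.
have [m pm E] := pfactor_coprime pp n0.
have m0 : (0 < m)%N by move: n0; rewrite E muln_gt0 => /andP[].
have pk0 : (0 < p ^ logn p n)%N by rewrite expn_gt0 prime_gt0.
rewrite {1}E r4M //; last by rewrite coprime_sym coprimeXl.
rewrite mulr_ge0 ?(r4_pfactor_ge0 _ pp) // IH // E -{1}[m]muln1 ltn_pmul2l //.
by rewrite -{1}(expn0 p) ltn_exp2l ?prime_gt1 // logn_gt0 mem_primes pp n0 pdiv_dvd.
Qed.

Lemma chi4_1mod4 (a : nat) : (a %% 4 = 1)%N -> chi4 a = 1.
Proof. by rewrite /chi4 => ->. Qed.

(** Without roots, nonnegativity of [r4] suffices. With a root, every divisor of m is 1 modulo 4, so
    [r4 m] is the full number of divisors. *)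
Lemma rho_le_r4 (m : nat) : odd m -> (rho m)%:R <= r4 m.
Proof.
move=> om; have m0 : (0 < m)%N by case: m om.
have [/eqP->|] := boolP (rho m == 0%N); first exact: r4_ge0.
rewrite {1}rhoE; case E: (sqrtN1_mod m) => [//|z s] _.
have : z \in sqrtN1_mod m by rewrite E mem_head.
rewrite mem_sqrtN1_mod => /andP[_ mz].
suff -> : r4 m = (size (divisors m))%:R by rewrite ler_nat rho_le_divisors.
rewrite /r4 big_seq (eq_bigr (fun=> 1)) => [|a]; last first.
  rewrite -dvdn_divisors // => am; apply: chi4_1mod4.
  exact: dvdn_sqr1_mod4 (dvdn_odd am om) (dvdn_trans am mz).
by rewrite -big_seq big_const_seq count_predT iter_addr_0.
Qed.

Definition r4_coprime6 (n : nat) : int := if coprime n 6 then r4 n else 0.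

Lemma r4_coprime6_ge0 (n : nat) : 0 <= r4_coprime6 n.
Proof.
rewrite /r4_coprime6; case: ifP => // cn; apply: r4_ge0.
by case: n cn.
Qed.

Lemma coprime6E (n : nat) : coprime n 6 = odd n && ~~ (3 %| n)%N.
Proof. by rewrite -[6%N]/(2 * 3)%N coprimeMr coprimen2 coprime_sym prime_coprime. Qed.

(** Roots exist only for d = m or d = 2m with m prime to 6. The two terms are never both nonzero;
    adding them lets the sum over d split in two. *)
Lemma rho_le_r4_coprime6 (d : nat) : (0 < d)%N ->
  (rho d)%:R <= r4_coprime6 d + (if (2 %| d)%N then r4_coprime6 (d %/ 2) else 0).
Proof.
move=> d0.
have [d3|d3] := boolP (3 %| d)%N.
  rewrite rho_mul3 // addr_ge0 ?r4_coprime6_ge0 //.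
  by case: ifP => // _; exact: r4_coprime6_ge0.
have [d2|d2] := boolP (2 %| d)%N; last first.
  have od : odd d by move: d2; rewrite dvdn2 negbK.
  by rewrite addr0 /r4_coprime6 coprime6E d3 od rho_le_r4.
have Ed := divnK d2; set m := (d %/ 2)%N in Ed *.
have [om|em] := boolP (odd m); last first.
  rewrite rho_mul4 ?addr_ge0 ?r4_coprime6_ge0 //.
  by rewrite -Ed -[4%N]/(2 * 2)%N dvdn_pmul2r // dvdn2 em.
rewrite ler_wpDl ?r4_coprime6_ge0 // /r4_coprime6 coprime6E om /=.
have -> /= : ~~ (3 %| m)%N by apply: contra d3; rewrite -Ed => /dvdn_mulr->.
by apply: le_trans (rho_le_r4 om); rewrite ler_nat -Ed muln2 rho_double.
Qed.

(** * Summation over d *)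

Lemma sum_multiples (V : nmodType) (F : nat -> V) (a N : nat) : (0 < a)%N ->
  \sum_(1 <= n < N.+1 | (a %| n)%N) F (n %/ a)%N = \sum_(1 <= b < (N %/ a).+1) F b.
Proof.
move=> a0; elim: N => [|N IH]; first by rewrite div0n !big_geq.
rewrite big_mkcond big_nat_recr //= -big_mkcond IH divnS //.
case: ifP => aN; last by rewrite addr0.
by rewrite aN add1n [RHS]big_nat_recr.
Qed.

Lemma chi4_coprime6_mod12 (K j : nat) :
  chi4 (j + 12 * K) = chi4 j /\ coprime (j + 12 * K) 6 = coprime j 6.
Proof.
rewrite addnC; split; first by rewrite /chi4 -[12%N]/(4 * 3)%N -mulnA mulnC modnMDl.
by rewrite -coprime_modl -[12%N]/(6 * 2)%N -mulnA mulnC modnMDl coprime_modl.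
Qed.

(* The character of modulus 12 induced by chi4 has the sign pattern + + - - on
   1, 5, 7, 11, so that past f 1 + f 5 the sum is made of nonpositive blocks. *)
Lemma sum_chi4_coprime6_le (R : realDomainType) (f : nat -> R) (K : nat) :
  (forall a b, (0 < a)%N -> (a <= b)%N -> f b <= f a) ->
  \sum_(1 <= a < (12 * K + 7) | coprime a 6) (chi4 a)%:~R * f a <= f 1%N + f 5%N.
Proof.
move=> fmono; elim: K => [|K IH].
  rewrite big_mkcond muln0 add0n /index_iota /= !big_cons big_nil /=.
  rewrite /chi4 /=; lra.
apply: le_trans IH; rewrite (@big_cat_nat _ _ _ (12 * K + 7)) /=; last 2 first.
- by rewrite addn_gt0 orbT.
- by rewrite leq_add2r leq_mul2l leqnSn orbT.
(* The new block, from 12K + 7 to 12K + 18, meets the integers prime to 6 at 12K plus 7, 11, 13, 17,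
   with signs - - + +. Monotonicity pairs 7 with 13 and 11 with 17. *)
rewrite gerDl addnC big_addn (_ : (12 * K.+1 + 7 - 12 * K = 19)%N); last by lia.
rewrite (eq_bigl (coprime^~ 6)) => [|j]; last by rewrite (chi4_coprime6_mod12 K j).2.
under eq_bigr => j _ do rewrite (chi4_coprime6_mod12 K j).1.
rewrite big_mkcond /index_iota /= !big_cons big_nil /=.
have := fmono (7 + 12 * K)%N (13 + 12 * K)%N isT; rewrite leq_add2r => /(_ isT).
have := fmono (11 + 12 * K)%N (17 + 12 * K)%N isT; rewrite leq_add2r => /(_ isT).
rewrite /chi4 /=; lra.
Qed.

Definition harmonic6 (R : fieldType) (N : nat) : R :=
  \sum_(1 <= b < N.+1 | coprime b 6) b%:R^-1.

(** This is ln (1 + t) <= t at t = x / y - 1; it will charge harmonic terms to increments of the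
    logarithm. *)
Lemma ln_ratio_ge (R : realType) (x y : nat) : (0 < x)%N -> (x <= y)%N ->
  (y%:R - x%:R) / y%:R <= ln y%:R - ln x%:R :> R.
Proof.
move=> x0 xy; have y0 : (0 < y)%N by apply: leq_trans xy.
have x0' : (0 : R) < x%:R by rewrite ltr0n.
have y0' : (0 : R) < y%:R by rewrite ltr0n.
have E : 1 + (x%:R / y%:R - 1) = x%:R / y%:R :> R by ring.
have := @le_ln1Dx R (x%:R / y%:R - 1).
rewrite E ln_div ?posrE // => /(_ _).
have p : 0 < x%:R / y%:R :> R by rewrite divr_gt0.
have -> : (y%:R - x%:R) / y%:R = 1 - x%:R / y%:R :> R by field; lra.
by move=> H; have := H ltac:(lra); lra.
Qed.

Lemma sum_divisors (V : nmodType) (F : nat -> V) (n N : nat) : (0 < n <= N)%N ->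
  \sum_(a <- divisors n) F a = \sum_(1 <= a < N.+1 | (a %| n)%N) F a.
Proof.
case/andP=> n0 nN; rewrite -[RHS]big_filter; apply: perm_big; apply: uniq_perm.
- exact: divisors_uniq.
- by rewrite filter_uniq ?iota_uniq.
move=> a; rewrite mem_filter mem_index_iota -dvdn_divisors // ltnS.
case: (boolP (a %| n)%N) => //= an.
by rewrite (dvdn_gt0 n0 an) (leq_trans (dvdn_leq n0 an)).
Qed.

Lemma harmonic6_ge0 (R : realFieldType) (N : nat) : 0 <= harmonic6 R N.
Proof. by apply: sumr_ge0 => b _; rewrite invr_ge0 ler0n. Qed.

Lemma le_harmonic6 (R : realFieldType) (M N : nat) :
  (M <= N)%N -> harmonic6 R M <= harmonic6 R N.
Proof.
move=> MN; rewrite [leRHS](@big_cat_nat _ _ _ M.+1) //= lerDl.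
by apply: sumr_ge0 => b _; rewrite invr_ge0 ler0n.
Qed.

(** On integers prime to 6, r4(n) / n is the Dirichlet convolution of chi4(a) / a and 1 / b. After
    exchanging the sums, the weight of chi4(a) is [f a], which decreases in a. *)
Lemma sum_r4_coprime6_le (R : realFieldType) (N : nat) :
  \sum_(1 <= n < N.+1) (r4_coprime6 n)%:~R / n%:R <= 6 / 5 * harmonic6 R N.
Proof.
pose w a : R := if coprime a 6 then (chi4 a)%:~R / a%:R else 0.
pose h b : R := if coprime b 6 then b%:R^-1 else 0.
pose f a := harmonic6 R (N %/ a) / a%:R.
have -> : \sum_(1 <= n < N.+1) (r4_coprime6 n)%:~R / n%:R =
    \sum_(1 <= n < N.+1) \sum_(1 <= a < N.+1 | (a %| n)%N) w a * h (n %/ a)%N.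
  rewrite big_nat [RHS]big_nat; apply: eq_bigr => n; rewrite ltnS => nN.
  rewrite -sum_divisors //; have n0 : (0 < n)%N by case/andP: nN.
  rewrite /r4_coprime6; case: ifPn => cn; last first.
    rewrite mul0r big_seq big1 // => a; rewrite -dvdn_divisors // => an.
    move: cn; rewrite -{1}(divnK an) coprimeMl negb_and /w /h => /orP[] /negPf->.
      by rewrite mulr0.
    by rewrite mul0r.
  rewrite /r4 rmorph_sum mulr_suml big_seq [RHS]big_seq; apply: eq_bigr => a.
  rewrite -dvdn_divisors // => an.
  move: cn; rewrite -{1}(divnK an) coprimeMl /w /h => /andP[-> ->].
  by rewrite -mulrA -invfM -natrM mulnC divnK.
rewrite (exchange_big_dep_nat xpredT) //=.
have -> : \sum_(1 <= a < N.+1) \sum_(1 <= n < N.+1 | (a %| n)%N) w a * h (n %/ a)%N =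
    \sum_(1 <= a < (12 * N + 7) | coprime a 6) (chi4 a)%:~R * f a.
  (* The range is stretched to the form 12K + 7 with K = N: for a > N, N %/ a = 0 and [f a]
     vanishes. *)
  rewrite [RHS](@big_cat_nat _ _ _ N.+1) /=; [|by []|by lia].
  rewrite [X in _ = _ + X]big_nat_cond [X in _ = _ + X]big1 ?addr0; last first.
    move=> a /andP[/andP[Na _] _].
    by rewrite /f divn_small // /harmonic6 big_geq // mul0r mulr0.
  rewrite [RHS]big_mkcond [LHS]big_nat [RHS]big_nat.
  apply: eq_bigr => a /andP[a0 _]; rewrite -mulr_sumr sum_multiples //.
  rewrite (_ : f a = (\sum_(1 <= b < (N %/ a).+1) h b) / a%:R); last first.
    by rewrite /f /harmonic6 big_mkcond.
  by rewrite /w; case: ifP => _; rewrite ?mul0r // mulrAC mulrA.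
have fmono a b : (0 < a)%N -> (a <= b)%N -> f b <= f a.
  move=> a0 ab; have b0 := leq_trans a0 ab.
  by rewrite ler_pM ?harmonic6_ge0 ?invr_ge0 ?ler0n ?le_harmonic6 ?leq_div2l
             ?lef_pV2 ?posrE ?ltr0n ?ler_nat.
apply: le_trans (sum_chi4_coprime6_le N fmono) _.
rewrite /f divn1 divr1.
have := le_harmonic6 R (leq_div N 5); lra.
Qed.

(** The terms d = m give 6/5 of the harmonic sum and the terms d = 2m at most half as much, hence
    9/5. *)
Lemma sum_rho_le (R : realFieldType) (N : nat) :
  \sum_(1 <= d < N.+1) (rho d)%:R / d%:R <= 9 / 5 * harmonic6 R N.
Proof.
pose F m : R := (r4_coprime6 m)%:~R / m%:R.
have F0 m : 0 <= F m by rewrite divr_ge0 ?ler0z ?r4_coprime6_ge0.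
apply: (@le_trans _ _ (\sum_(1 <= d < N.+1) F d +
    \sum_(1 <= d < N.+1 | (2 %| d)%N) F (d %/ 2)%N / 2)).
  rewrite [X in _ + X]big_mkcond -big_split /= big_nat [leRHS]big_nat.
  apply: ler_sum => d /andP[d0 _].
  have -> : F d + (if (2 %| d)%N then F (d %/ 2)%N / 2 else 0) =
      (r4_coprime6 d + (if (2 %| d)%N then r4_coprime6 (d %/ 2) else 0))%:~R / d%:R.
    rewrite rmorphD /= mulrDl /F; congr (_ + _); case: ifP => d2; last by rewrite mul0r.
    by rewrite -mulrA -invfM -natrM divnK.
  rewrite ler_pM2r ?invr_gt0 ?ltr0n //.
  by rewrite -[(rho d)%:R]mulrz_nat ler_int rho_le_r4_coprime6.
rewrite -[X in _ + X]mulr_suml (@sum_multiples _ F 2 N) //.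
have := sum_r4_coprime6_le R N; rewrite -/F.
have : \sum_(1 <= m < (N %/ 2).+1) F m <= \sum_(1 <= m < N.+1) F m.
  rewrite [leRHS](@big_cat_nat _ _ _ (N %/ 2).+1) //= ?ltnS ?leq_div // lerDl.
  exact: sumr_ge0.
lra.
Qed.

(** Let p = 1/(6K + 5) and q = 1/(6K + 7). From 6K + 1 to 6K + 7 the sum gains p + q and the
    logarithm at least 4p + 2q, a third of which is at least p + q because q <= p. *)
Lemma harmonic6_le_ln (R : realType) (N : nat) : (0 < N)%N ->
  harmonic6 R N <= 1 + ln N%:R / 3.
Proof.
have coprime_mod6 K j : coprime (6 * K + j) 6 = coprime j 6.
  by rewrite -coprime_modl mulnC modnMDl coprime_modl.
have harmonicS n : harmonic6 R n.+1 =
    harmonic6 R n + (if coprime n.+1 6 then n.+1%:R^-1 else 0).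
  by rewrite /harmonic6 big_mkcond big_nat_recr //= -big_mkcond.
have ln_mono (x y : nat) : (0 < x)%N -> (x <= y)%N -> ln x%:R <= ln y%:R :> R.
  by move=> x0 xy; rewrite ler_ln ?posrE ?ltr0n ?ler_nat // (leq_trans x0).
have same K j : (j < 4)%N -> harmonic6 R (6 * K + 1 + j) = harmonic6 R (6 * K + 1).
  elim: j => [|j IH] j4; first by rewrite addn0.
  rewrite addnS harmonicS IH; last exact: ltnW.
  rewrite -addnS -addnA coprime_mod6.
  by case: j j4 {IH} => [|[|[|]]] //= _; rewrite addr0.
have H4 K : harmonic6 R (6 * K + 1 + 4) = harmonic6 R (6 * K + 1) + (6 * K + 5)%:R^-1.
  by rewrite addnS harmonicS same // -addnS -addnA coprime_mod6.
have H5 K : harmonic6 R (6 * K + 1 + 5) = harmonic6 R (6 * K + 1) + (6 * K + 5)%:R^-1.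
  by rewrite addnS harmonicS H4 -addnS -addnA coprime_mod6 /= addr0.
have H6 K : harmonic6 R (6 * K + 1 + 6) =
    harmonic6 R (6 * K + 1) + (6 * K + 5)%:R^-1 + (6 * K + 7)%:R^-1.
  by rewrite addnS harmonicS H5 -addnS -addnA coprime_mod6.
have ln4 K : 4 * (6 * K + 5)%:R^-1 <= ln (6 * K + 5)%:R - ln (6 * K + 1)%:R :> R.
  have -> : 4 = (6 * K + 5)%:R - (6 * K + 1)%:R :> R by rewrite !natrD; ring.
  by rewrite ln_ratio_ge ?leq_add2l ?addn_gt0 ?orbT.
have ln2 K : 2 * (6 * K + 7)%:R^-1 <= ln (6 * K + 7)%:R - ln (6 * K + 5)%:R :> R.
  have -> : 2 = (6 * K + 7)%:R - (6 * K + 5)%:R :> R by rewrite !natrD; ring.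
  by rewrite ln_ratio_ge ?leq_add2l ?addn_gt0 ?orbT.
have base K : harmonic6 R (6 * K + 1) <= 1 + ln (6 * K + 1)%:R / 3.
  elim: K => [|K IH].
    rewrite muln0 add0n harmonicS /harmonic6 big_geq //= invr1 ln1.
    by rewrite add0r mul0r addr0.
  rewrite (_ : 6 * K.+1 + 1 = 6 * K + 1 + 6)%N ?H6; last by lia.
  rewrite (_ : 6 * K + 1 + 6 = 6 * K + 7)%N; last by lia.
  have pq : (6 * K + 7)%:R^-1 <= (6 * K + 5)%:R^-1 :> R.
    by rewrite lef_pV2 ?posrE ?ltr0n ?ler_nat; lia.
  have := ln4 K; have := ln2 K; lra.
(* Write N = 6K + 1 + j with j < 6. For j < 4 the sum has not grown since 6K + 1; for j = 4 or 5 it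
   has gained only p, which is at most 4p / 3. *)
move=> N0; rewrite (_ : N = 6 * (N.-1 %/ 6) + 1 + N.-1 %% 6)%N; last first.
  by rewrite mulnC addnAC -divn_eq addn1 prednK.
move: (N.-1 %/ 6)%N (N.-1 %% 6)%N (ltn_pmod N.-1 (isT : 0 < 6)%N) => K j j6.
have mono : ln (6 * K + 1)%:R <= ln (6 * K + 1 + j)%:R :> R.
  by apply: ln_mono; rewrite ?leq_addr ?addn1.
have bK := base K.
have [j4|] := ltnP j 4; first by rewrite same //; lra.
have p0 : 0 <= (6 * K + 5)%:R^-1 :> R by rewrite invr_ge0 ler0n.
move=> j4; have mono' : ln (6 * K + 5)%:R <= ln (6 * K + 1 + j)%:R :> R.
  by apply: ln_mono; lia.
suff -> : harmonic6 R (6 * K + 1 + j) = harmonic6 R (6 * K + 1) + (6 * K + 5)%:R^-1.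
  have := ln4 K; lra.
have /orP[/eqP->|/eqP->] : (j == 4) || (j == 5) by lia.
  exact: H4.
exact: H5.
Qed.

Theorem theorem1p2 (R : realType) (N : nat) (hN : (1 <= N)%N) :
  (\sum_(1 <= n < N.+1) tau (n ^ 2 + 1))%N%:R
    < (1216 / 1000) * (N%:R * ln N%:R) + (4332 / 1000) * N%:R :> R.
Proof.
have N0 : 0 < N%:R :> R by rewrite ltr0n.
have L0 : 0 <= ln N%:R :> R by rewrite ln_ge0 // ler1n.
apply: (@le_lt_trans _ _ (2 * (N%:R * (9 / 5 * harmonic6 R N)))).
  apply: (@le_trans _ _ (2 * \sum_(1 <= d < N.+1) rho d * (N %/ d))%N%:R).
    by rewrite ler_nat sum_tau_le_rho.
  rewrite natrM ler_pM2l ?ltr0n //.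
  apply: (@le_trans _ _ (N%:R * \sum_(1 <= d < N.+1) (rho d)%:R / d%:R)); last first.
    by rewrite ler_pM2l // sum_rho_le.
  rewrite natr_sum mulr_sumr big_nat [leRHS]big_nat; apply: ler_sum => d /andP[d0 _].
  rewrite natrM mulrCA ler_wpM2l ?ler0n //.
  by rewrite ler_pdivlMr ?ltr0n // -natrM ler_nat leq_trunc_div.
(* The bound is now 6/5 N ln N + 18/5 N. Since ln N >= 0 and N > 0, strictness comes from 18/5 <
   4.332. *)
have := harmonic6_le_ln R hN.
rewrite -(ler_pM2l N0); have := mulr_ge0 (ltW N0) L0; lra.
Qed.
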